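(* Let $c=v=2$, let $W_\infty\in\mathcal W_2$ satisfy $\int_0^1W_\infty(x,y)\,dy=1$ for Lebesgue-a.e. $x$ and $W_\infty>0$ Lebesgue-a.e., let $\mu(\{1\})=p$, $\mu(\{2\})=1-p$ with $p\in(1/2,1)$, and let $\boldsymbol{\alpha}=(\alpha_1,\alpha_2)$ with $\alpha_1=\alpha_2\ge0$. Then for $y\in[p^2+(1-p)^2,1)$, $$I_{W_\infty,(1,1)}(y)=q_y\log\Big(\frac{q_y}p\Big)+(1-q_y)\log\Big(\frac{1-q_y}{1-p}\Big),$$ where $q_y>1/2$ is the unique solution of $q^2+(1-q)^2=y$.
   Context: $\mathcal W_2$ is the space of symmetric real-valued functions in $L^1([0,1]^2)$. $\mathcal F_2$ is the set of measurable $\boldsymbol f=(f_1,f_2):[0,1]\to[0,1]^2$ with $f_1(x)+f_2(x)=1$ for all $x$ (modulo a.e. equality). For $W\in\mathcal W_2$, $G_{W,\mathbf 1_r}(\boldsymbol f):=\int_{[0,1]^2}W(x_1,x_2)f_r(x_1)f_r(x_2)\,dx_1dx_2$. For $(a_1,a_2)\in\mathbb R^2$, $$I_{W_\infty,(a_1,a_2)}(t):=\inf_{\boldsymbol f\in\mathcal F_2:\ a_1G_{W_\infty,\mathbf 1_1}(\boldsymbol f)+a_2G_{W_\infty,\mathbf 1_2}(\boldsymbol f)=t}\left\{\int_0^1\sum_{r=1}^2 f_r(u)\log f_r(u)\,du-\sum_{r=1}^2h_r\int_0^1f_r(u)\,du\right\}+\log(e^{h_1}+e^{h_2}),$$ where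 $\boldsymbol h\in\mathbb R^2$ is such that $\mu(\{r\})=e^{h_r}/(e^{h_1}+e^{h_2})$, $r=1,2$. Conventions: $0\log0=0$, $\inf\emptyset=+\infty$. *)

(* Defs.v *)
From HB Require Import structures.
From mathcomp Require Import all_boot all_order all_algebra.
From mathcomp Require Import all_classical all_reals all_analysis.

Set Implicit Arguments.
Unset Strict Implicit.
Unset Printing Implicit Defensive.

Import Order.TTheory GRing.Theory Num.Theory.
Import numFieldNormedType.Exports.

Local Open Scope classical_set_scope.
Local Open Scope ring_scope.

(* The colours 1, 2 are [ord0, ord_max : 'I_2].  Functions on [0,1] (resp.
   [0,1]^2) are functions on [R] (resp. [R * R]) of which only the restriction
   to the interval (resp. square) matters. *)

Definition unit_interval (R : realType) : set (measurableTypeR R) :=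
  [set` `[0%R, 1%R]].
Arguments unit_interval R : clear implicits.

Definition unit_square (R : realType) :
    set (measurableTypeR R * measurableTypeR R) :=
  unit_interval R `*` unit_interval R.
Arguments unit_square R : clear implicits.

Notation leb R := (@lebesgue_measure R).
Notation leb2 R := (leb R \x leb R)%E.

(* An element of L^1 is a class modulo a.e. equality, so the symmetry of a
   representative is only required almost everywhere. *)
Definition graphon_space (R : realType)
    (W : measurableTypeR R * measurableTypeR R -> R) : Prop :=
  (leb2 R).-integrable (unit_square R) (EFin \o W) /\
  {ae leb2 R, forall z, unit_square R z -> W z = W (z.2, z.1)}.

(* Representatives of the elements of F_2; passing to classes modulo a.e.
   equality is immaterial since they only enter through integrals. *)
Definition colour_profile (R : realType) (f : 'I_2 -> measurableTypeR R -> R) :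
    Prop :=
  [/\ forall r, measurable_fun (unit_interval R) (f r),
      forall r x, unit_interval R x -> 0 <= f r x <= 1
    & forall x, unit_interval R x -> f ord0 x + f ord_max x = 1].

(* G_{W,1_r}(f); the integrand is integrable for W in L^1 and f in F_2. *)
Definition mono_density (R : realType)
    (W : measurableTypeR R * measurableTypeR R -> R) (r : 'I_2)
    (f : 'I_2 -> measurableTypeR R -> R) : R :=
  \int[leb2 R]_(z in unit_square R) (W z * f r z.1 * f r z.2).

(* [ln 0 = 0] in the library, hence 0 log 0 = 0. *)
Definition entropy_energy (R : realType) (h : 'I_2 -> R)
    (f : 'I_2 -> measurableTypeR R -> R) : R :=
  \int[leb R]_(u in unit_interval R) (\sum_(r < 2) f r u * ln (f r u))
  - \sum_(r < 2) h r * \int[leb R]_(u in unit_interval R) f r u.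

(* I_{W,(a_1,a_2)}(t), with value in the extended reals: [ereal_inf set0] is
   +oo. *)
Definition rate_function (R : realType) (h : 'I_2 -> R)
    (W : measurableTypeR R * measurableTypeR R -> R) (a : 'I_2 -> R) (t : R) :
    \bar R :=
  (ereal_inf [set (entropy_energy h f)%:E | f in
     [set f | colour_profile f /\
              (a ord0 * mono_density W ord0 f
               + a ord_max * mono_density W ord_max f = t)%R]]
   + (ln (expR (h ord0) + expR (h ord_max)))%:E)%E.

(* Main.v *)
(* Since W is nonnegative and has degree 1, the bound 2 f(x) f(y) <= f(x)^2 +
   f(y)^2 gives G_r(f) <= \int f_r^2, with equality for constant profiles, so
   the constraint at level y forces \int (f_1^2 + f_2^2) >= q_y^2 + (1 - q_y)^2.
   On [0,1], x log x + (1 - x) log (1 - x) lies above its tangent at q in the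
   variable x^2 - x (equivalently in (2 x - 1)^2, in which it is convex because
   the logit is convex on [1/2, 1[).  Integrating this tangent bound, the
   remaining linear term in \int f_1 is absorbed by \int (f_1 - q)^2 >= 0, and
   q >= p gives the right sign.  Hence the constant profile (q, 1 - q), which
   satisfies the constraint, is a minimizer. *)
Require Import Defs.
From HB Require Import structures.
From mathcomp Require Import all_boot all_order all_algebra.
From mathcomp Require Import all_classical all_reals all_analysis.
From mathcomp Require Import measurable_realfun.
From mathcomp Require Import ring lra.

Set Implicit Arguments.
Unset Strict Implicit.
Unset Printing Implicit Defensive.

Import Order.TTheory GRing.Theory Num.Theory.
Import numFieldNormedType.Exports.

Local Open Scope classical_set_scope.
Local Open Scope ring_scope.

(** * Calculus in one variable: convexity of the logit and a tangent bound for the binary entropy *)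

Lemma MVT_derivable (R : realType) (f df : R -> R) (a b c d : R) :
  (forall x, a < x < b -> is_derive x 1 f (df x)) ->
  a < c -> c < d -> d < b ->
  exists2 x, c < x < d & f d - f c = df x * (d - c).
Proof.
move=> fd ac cd db.
have [|||x] := @MVT R f df c d; first exact: cd.
- by move=> x; rewrite in_itv/= => /andP[cx xd]; apply: fd; lra.
- apply: derivable_within_continuous => x; rewrite in_itv/= => /andP[cx xd].
  by apply: (@ex_derive _ _ _ _ _ _ _ (fd x _)); lra.
by rewrite in_itv/= => cxd E; exists x.
Qed.

Definition logit (R : realType) (x : R) : R := ln x - ln (1 - x).

Definition neg_entropy (R : realType) (x : R) : R :=
  x * ln x + (1 - x) * ln (1 - x).

Lemma is_derive_ln_onem (R : realType) (x : R) : x < 1 ->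
  is_derive x 1 (fun t : R => ln (1 - t)) (- (1 - x)^-1).
Proof.
move=> x1; have x0 : 0 < 1 - x by lra.
have := @is_derive1_comp R (@ln R) (fun t : R => 1 - t) x _ _
  (is_derive1_ln x0) _.
move=> /(_ (- 1))[|dl vl].
  by apply: is_derive_eq; rewrite add0r mul1r.
by split; rewrite // vl mulrN1.
Qed.

Lemma is_derive_logit (R : realType) (x : R) : 0 < x < 1 ->
  is_derive x 1 (@logit R) (x^-1 + (1 - x)^-1).
Proof.
move=> /andP[x0 x1].
have ? := is_derive1_ln x0; have ? := is_derive_ln_onem x1.
rewrite /logit; apply: is_derive_eq.
by rewrite opprK.
Qed.

Lemma is_derive_neg_entropy (R : realType) (x : R) : 0 < x < 1 ->
  is_derive x 1 (@neg_entropy R) (logit x).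
Proof.
move=> /andP[x0 x1].
have ? := is_derive1_ln x0; have ? := is_derive_ln_onem x1.
rewrite /neg_entropy; apply: is_derive_eq.
rewrite /logit /GRing.scale/=; field; apply/andP; split; apply: lt0r_neq0; lra.
Qed.

Lemma neg_entropyC (R : realType) (x : R) : neg_entropy (1 - x) = neg_entropy x.
Proof. by rewrite /neg_entropy subKr addrC. Qed.

Lemma neg_entropy_le0 (R : realType) (x : R) :
  0 <= x <= 1 -> neg_entropy x <= 0.
Proof.
move=> /andP[x0 x1]; rewrite /neg_entropy -oppr_ge0 opprD addr_ge0// -mulrN;
  rewrite mulr_ge0 ?oppr_ge0 ?ln_le0//; lra.
Qed.

Lemma ler_logit (R : realType) (p q : R) : 0 < p -> p <= q -> q < 1 ->
  logit p <= logit q.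
Proof.
move=> p0 pq q1; rewrite /logit lerB// ler_ln ?posrE; lra.
Qed.

(** Both sides are values of the derivative of [logit], which equals [(z * (1 - z))^-1], and
    [z * (1 - z)] decreases beyond [1 / 2]. This is the convexity of the logit on the upper half of
    the interval. *)
Lemma inv_onem_incr (R : realType) (x y : R) :
  1 / 2 <= x -> x <= y -> y < 1 ->
  x^-1 + (1 - x)^-1 <= y^-1 + (1 - y)^-1.
Proof.
move=> x2 xy y1.
have inv (z : R) : 0 < z < 1 -> z^-1 + (1 - z)^-1 = (z * (1 - z))^-1.
  by move=> z01; field; apply/andP; split; apply: lt0r_neq0; lra.
rewrite !inv; [|lra|lra].
have y0 : 0 < y * (1 - y) by rewrite mulr_gt0; lra.
rewrite lef_pV2 ?posrE//; first by nra.
by rewrite mulr_gt0; lra.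
Qed.

Lemma onem_half (R : realType) : 1 - 1 / 2 = 1 / 2 :> R.
Proof. by field. Qed.

Lemma logit_half (R : realType) : logit (1 / 2) = 0 :> R.
Proof. by rewrite /logit onem_half subrr. Qed.

(** Here [e] is the value at an interior point of a function vanishing at both ends of an interval,
    [s] and [t] are the distances to the ends, and [a] and [b] are the slopes of the left and right
    secants. Slopes that increase force a nonpositive value. *)
Lemma secant_slopes_le0 (R : realFieldType) (a b s t e : R) :
  0 < s -> 0 < t -> a <= b -> e = a * s -> - e = b * t -> e <= 0.
Proof.
move=> s0 t0 ab es et; rewrite -(pmulr_lle0 _ (addr_gt0 s0 t0)).
have -> : e * (s + t) = - ((b - a) * (s * t)).
  by rewrite mulrDr -[e * s]opprK -mulNr et es; ring.
by rewrite oppr_le0 mulr_ge0 ?subr_ge0// mulr_ge0// ltW.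
Qed.

(** The line [k * (2 * x - 1)] meets the graph of the logit at [1 / 2] and at [q]. A convex function
    lies below such a chord between the two points and above its continuation to the right. *)
Lemma logit_chord (R : realType) (q k x : R) : 1 / 2 < q -> q < 1 ->
  k * (2 * q - 1) = logit q ->
  (1 / 2 <= x <= q -> logit x <= k * (2 * x - 1)) /\
  (q <= x < 1 -> k * (2 * x - 1) <= logit x).
Proof.
move=> q2 q1 kq; pose E (x : R) := logit x - k * (2 * x - 1).
have dE (t : R) : 0 < t < 1 -> is_derive t 1 E (t^-1 + (1 - t)^-1 - k * 2).
  move=> t01; have ? := is_derive_logit t01.
  rewrite /E; apply: is_derive_eq.
  by rewrite /GRing.scale/=; ring.
have E2 : E (1 / 2) = 0 by rewrite /E logit_half; field.
have Eq : E q = 0 by rewrite /E kq subrr.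
split=> /andP[].
- rewrite -[logit x <= _]subr_le0 -/(E x).
  rewrite le_eqVlt => /predU1P[<-|x2]; first by rewrite E2.
  rewrite le_eqVlt => /predU1P[->|xq]; first by rewrite Eq.
  have [|||c /andP[c1 c2] Ec] :=
    MVT_derivable dE (c := 1 / 2) (d := x); [lra..|].
  have [|||d /andP[d1 d2] Ed] :=
    MVT_derivable dE (c := x) (d := q); [lra..|].
  have := inv_onem_incr (ltW c1) (ltW (lt_trans c2 d1)) (lt_trans d2 q1).
  rewrite -[_ + _ <= _](lerD2r (- (k * 2))) => cd.
  apply: (secant_slopes_le0 (s := x - 1 / 2) (t := q - x) _ _ cd).
  + by rewrite subr_gt0.
  + by rewrite subr_gt0.
  + by rewrite -Ec E2 subr0.
  + by rewrite -Ed Eq sub0r.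
- rewrite -[_ <= logit x]subr_ge0 -/(E x).
  rewrite le_eqVlt => /predU1P[<-|xq] x1; first by rewrite Eq.
  (* Since [E] vanishes at [1 / 2] and at [q], its derivative is zero at [c]; being nondecreasing,
     it is nonnegative at the later point [d]. *)
  have [|||c /andP[c1 c2] Ec] :=
    MVT_derivable dE (c := 1 / 2) (d := q); [lra..|].
  have [|||d /andP[d1 d2] Ed] :=
    MVT_derivable dE (c := q) (d := x); [lra..|].
  have := inv_onem_incr (ltW c1) (ltW (lt_trans c2 d1)) (lt_trans d2 x1).
  rewrite -[_ + _ <= _](lerD2r (- (k * 2))).
  move: Ec => /esym/eqP; rewrite E2 Eq subrr mulf_eq0.
  rewrite [q - _ == 0]subr_eq0 (gt_eqF q2) orbF.
  move=> /eqP-> b0; move: Ed; rewrite Eq subr0 => ->.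
  by rewrite mulr_ge0// subr_ge0 ltW.
Qed.

(** The difference [D] has derivative [logit t - k * (2 * t - 1)], whose sign is given by
    [logit_chord]: nonpositive on the left of [q], nonnegative on the right. Hence [D] is smallest
    at [q]. *)
Lemma neg_entropy_tangent_half (R : realType) (q k x : R) :
  1 / 2 < q -> q < 1 -> k * (2 * q - 1) = logit q -> 1 / 2 <= x < 1 ->
  neg_entropy q + k * (x * (x - 1) - q * (q - 1)) <= neg_entropy x.
Proof.
move=> q2 q1 kq /andP[x2 x1].
pose D (x : R) := neg_entropy x - k * (x * (x - 1)).
suff : D q <= D x by rewrite /D; lra.
have dD (t : R) : 0 < t < 1 -> is_derive t 1 D (logit t - k * (2 * t - 1)).
  move=> t01; have ? := is_derive_neg_entropy t01.
  rewrite /D; apply: is_derive_eq.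
  by rewrite /GRing.scale/=; ring.
have [xq|qx|->//] := ltgtP x q.
- have [|||c /andP[c1 c2] Dc] := MVT_derivable dD (c := x) (d := q); [lra..|].
  have [/(_ _)] := logit_chord c q2 q1 kq; nra.
- have [|||c /andP[c1 c2] Dc] := MVT_derivable dD (c := q) (d := x); [lra..|].
  have [_] := logit_chord c q2 q1 kq; nra.
Qed.

(** Both [neg_entropy x] and [x * (x - 1)] are invariant under the exchange of [x] and [1 - x],
    which reduces the bound to the upper half of the interval. *)
Lemma neg_entropy_tangent (R : realType) (q k x : R) :
  1 / 2 < q -> q < 1 -> k * (2 * q - 1) = logit q -> 0 <= x <= 1 ->
  neg_entropy q + k * (x * (x - 1) - q * (q - 1)) <= neg_entropy x.
Proof.
move=> q2 q1 kq x01.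
wlog x2 : x x01 / 1 / 2 <= x => [half|].
  have [/half|x2] := leP (1 / 2) x; first exact.
  by have := half (1 - x); rewrite neg_entropyC; nra.
case/andP: x01 => _; rewrite le_eqVlt => /predU1P[->{x x2}|x1]; last first.
  by apply: neg_entropy_tangent_half => //; apply/andP.
have -> : neg_entropy 1 = 0 :> R.
  by rewrite /neg_entropy ln1 subrr mul0r mulr0 addr0.
have k0 : 0 <= k.
  have : 0 <= logit q by rewrite -logit_half; apply: ler_logit; lra.
  by rewrite -kq; nra.
(* At the endpoint 1, let x = 1 - e tend to 1 in the bound for x < 1, where
   [neg_entropy x <= 0]. *)
rewrite subrr mulr0 leNgt; apply/negP; set d := _ + _ => d0.
(* The bound at [1 - e] would give [d <= k * e * (1 - e)]. This choice of [e] ensures both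
   [e < 1 / 2] and [k * e < d], a contradiction. *)
pose e := d / (2 * (d + k + 1)).
have dk0 : 0 < 2 * (d + k + 1) by lra.
have eE : e * (2 * (d + k + 1)) = d by rewrite divfK// gt_eqF.
have e0 : 0 < e by rewrite divr_gt0.
have e2 : e < 1 / 2 by nra.
have e01 : 0 <= 1 - e <= 1 by lra.
have e12 : 1 / 2 <= 1 - e < 1 by lra.
have := neg_entropy_tangent_half q2 q1 kq e12.
have := neg_entropy_le0 e01.
rewrite /d in d0 eE *; nra.
Qed.

(** * Integrals over the unit square against a graphon of degree one *)

(** For a nonnegative integrand, Tonelli's theorem in its two orders yields the same iterated
    integral. The general case treats positive and negative parts separately. *)
Lemma integral_prod_swap d (T : measurableType d) (R : realType)
    (m : {sigma_finite_measure set T -> \bar R}) (D : set T)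
    (F : T * T -> \bar R) : measurable D ->
  measurable_fun (D `*` D) F ->
  (\int[m \x m]_(z in D `*` D) F (z.2, z.1) =
   \int[m \x m]_(z in D `*` D) F z)%E.
Proof.
move=> mD mF; have mDD := measurableX mD mD.
have ge0_swap (K : T * T -> \bar R) : measurable_fun setT K ->
    (forall z, 0 <= K z)%E ->
    (\int[m \x m]_z K (z.2, z.1) = \int[m \x m]_z K z)%E.
  move=> mK K0.
  rewrite (fubini_tonelli2 K)//.
  rewrite (fubini_tonelli1 (fun z => K (z.2, z.1)))//.
  by apply: measurableT_comp => //; exact: measurable_swap.
rewrite integral_mkcond [RHS]integral_mkcond.
have mFD := (measurable_restrictT F mDD).1 mF.
have -> : (fun z => F (z.2, z.1)) \_ (D `*` D) =
    (fun z => (F \_ (D `*` D)) (z.2, z.1)).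
  apply/funext => -[x y]; rewrite /patch/=; congr (if _ then _ else _).
  by apply/idP/idP; rewrite !inE/= => -[].
set G := F \_ _ in mFD *.
rewrite integralE [RHS]integralE; congr (_ - _)%E.
- rewrite -(ge0_swap G^\+%E)//; last exact: measurable_funepos.
  by apply: eq_integral => z _; rewrite !funeposE.
- rewrite -(ge0_swap G^\-%E)//; last exact: measurable_funeneg.
  by apply: eq_integral => z _; rewrite !funenegE.
Qed.

Lemma integrable_graphonM (R : realType)
    (W k : measurableTypeR R * measurableTypeR R -> R) (M : R) :
  graphon_space W -> measurable_fun (unit_square R) k ->
  (forall z, unit_square R z -> `|k z| <= M) ->
  (leb2 R).-integrable (unit_square R) (EFin \o (fun z => W z * k z)).
Proof.
move=> [iW _] mk kM.
have mI : measurable (unit_interval R) by exact: measurable_itv.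
have mS : measurable (unit_square R) by exact: measurableX.
apply: (integrableMl mS iW mk).
exists M; split; first exact: num_real.
by move=> N MN z Sz; rewrite /= (le_trans (kM z Sz))// ltW.
Qed.

Lemma measurable_comp_fst (R : realType) (u : measurableTypeR R -> R) :
  measurable_fun (unit_interval R) u ->
  measurable_fun (unit_square R) (fun z => u z.1).
Proof.
move=> mu; apply: (measurable_comp (F := unit_interval R)) => //.
- exact: measurable_itv.
- by move=> _ [z [z1 _] <-].
- exact: measurable_funTS.
Qed.

Lemma measurable_comp_snd (R : realType) (u : measurableTypeR R -> R) :
  measurable_fun (unit_interval R) u ->
  measurable_fun (unit_square R) (fun z => u z.2).
Proof.
move=> mu; apply: (measurable_comp (F := unit_interval R)) => //.
- exact: measurable_itv.
- by move=> _ [z [_ z2] <-].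
- exact: measurable_funTS.
Qed.

Section graphon.
Variables (R : realType) (W : measurableTypeR R * measurableTypeR R -> R).
Hypothesis hW : graphon_space W.
Hypothesis hWdeg : {ae leb R, forall x, unit_interval R x ->
  (\int[leb R]_(y in unit_interval R) (W (x, y))%:E = 1)%E}.

Let mI : measurable (unit_interval R). Proof. exact: measurable_itv. Qed.
Let mS : measurable (unit_square R). Proof. exact: measurableX. Qed.

Variables (u : measurableTypeR R -> R) (M : R).
Hypothesis mu : measurable_fun (unit_interval R) u.
Hypothesis uM : forall x, unit_interval R x -> `|u x| <= M.

(** By Fubini, the inner integral over the second variable is [u x] times the degree of [W] at [x],
    which is one for almost every [x]. *)
Lemma integral_graphon_fst :
  (\int[leb2 R]_(z in unit_square R) (W z * u z.1)%:E =
   \int[leb R]_(x in unit_interval R) (u x)%:E)%E.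
Proof.
have iWu : (leb2 R).-integrable (unit_square R)
    (EFin \o (fun z => W z * u z.1)).
  apply: (integrable_graphonM hW (measurable_comp_fst mu)) => z [z1 _].
  exact: uM.
have restr (k : measurableTypeR R * measurableTypeR R -> R) :
    (leb2 R).-integrable (unit_square R) (EFin \o k) ->
    (leb2 R).-integrable setT ((EFin \o k) \_ (unit_square R)).
  by move=> ik; apply/integrable_restrict => //; rewrite setTI.
have iWT := restr _ hW.1; have iWuT := restr _ iWu.
rewrite integral_mkcond -(integral12_prod_meas1 iWuT) [RHS]integral_mkcond.
apply: ae_eq_integral => //.
- exact: measurable_fubini_F iWuT.
- by apply/(measurable_restrictT _ mI); exact/measurable_EFinP.
apply: filterS2 hWdeg (ae_integrable1 iWT) => x degx iWx _.
(* Functions on the square are extended by zero to the whole plane for Fubini, so both sides vanish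
   when [x] is outside the unit interval. *)
have [Ix|nIx] := pselect (unit_interval R x); last first.
  rewrite /fubini_F integral0_eq/= ?patchE ?memNset// => y _.
  by rewrite patchE memNset// => -[].
have SE y : unit_interval R y -> unit_square R (x, y) by [].
have xE (k : measurableTypeR R * measurableTypeR R -> R) :
    (fun y => ((EFin \o k) \_ (unit_square R)) (x, y)) =
    (fun y => (k (x, y))%:E) \_ (unit_interval R).
  apply/funext => y; rewrite !patchE.
  have [Iy|nIy] := pselect (unit_interval R y); first by rewrite !mem_set.
  by rewrite !memNset// => -[].
rewrite /fubini_F xE -integral_mkcond patchE mem_set//=.
under eq_integral do rewrite mulrC EFinM.
rewrite integralZl//; first by rewrite degx// mule1.
move: iWx; rewrite xE => iWx.
have := (integrable_restrict (leb R) mI measurableT _).2 iWx.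
by rewrite setTI.
Qed.

(** The degree condition integrates out the second variable only; the almost everywhere symmetry of
    [W] and the exchange of coordinates transfer it to the first. *)
Lemma integral_graphon_snd :
  (\int[leb2 R]_(z in unit_square R) (W z * u z.2)%:E =
   \int[leb R]_(x in unit_interval R) (u x)%:E)%E.
Proof.
rewrite -integral_graphon_fst.
have iWu1 : (leb2 R).-integrable (unit_square R)
    (EFin \o (fun z => W z * u z.1)).
  apply: (integrable_graphonM hW (measurable_comp_fst mu)) => z [z1 _].
  exact: uM.
have iWu2 : (leb2 R).-integrable (unit_square R)
    (EFin \o (fun z => W z * u z.2)).
  apply: (integrable_graphonM hW (measurable_comp_snd mu)) => z [_ z2].
  exact: uM.
rewrite -(integral_prod_swap (leb R) mI (measurable_int _ iWu1)).
apply: ae_eq_integral => //.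
- exact: measurable_int iWu2.
- apply: (measurable_comp (F := unit_square R)
    (g := fun z => (z.2, z.1))) => //.
  + by move=> _ [z [z1 z2] <-].
  + exact: measurable_int iWu1.
  by apply: measurable_funTS; exact: measurable_swap.
- case: hW => _; apply: filterS => z Wz Sz /=.
  by rewrite Wz.
Qed.

End graphon.

(** The integral of [W z * (u z.1 - u z.2) ^+ 2] is nonnegative. Expanding the square, each of the
    two pure terms integrates to the right-hand side and the cross term is twice the left-hand
    side. *)
Lemma integral_graphon_diag (R : realType)
    (W : measurableTypeR R * measurableTypeR R -> R)
    (u : measurableTypeR R -> R) (M : R) :
  graphon_space W ->
  {ae leb R, forall x, unit_interval R x ->
    (\int[leb R]_(y in unit_interval R) (W (x, y))%:E = 1)%E} ->
  {ae leb2 R, forall z, unit_square R z -> 0 <= W z} ->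
  measurable_fun (unit_interval R) u ->
  (forall x, unit_interval R x -> `|u x| <= M) ->
  \int[leb2 R]_(z in unit_square R) (W z * u z.1 * u z.2)
    <= \int[leb R]_(x in unit_interval R) u x ^+ 2.
Proof.
move=> hW hWdeg W0 mu uM.
have mI : measurable (unit_interval R) by exact: measurable_itv.
have mS : measurable (unit_square R) by exact: measurableX.
have mu2 : measurable_fun (unit_interval R) (fun x => u x ^+ 2).
  exact: measurable_funX.
have uM2 x : unit_interval R x -> `|u x ^+ 2| <= M ^+ 2.
  by move=> Ix; rewrite normrX lerXn2r ?nnegrE ?uM// (le_trans _ (uM x Ix)).
have mu1 := measurable_comp_fst mu; have mu1' := measurable_comp_snd mu.
pose A (z : measurableTypeR R * measurableTypeR R) := W z * u z.1 ^+ 2.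
pose B (z : measurableTypeR R * measurableTypeR R) := W z * u z.2 ^+ 2.
pose C (z : measurableTypeR R * measurableTypeR R) := W z * u z.1 * u z.2.
have iA : (leb2 R).-integrable (unit_square R) (EFin \o A).
  apply: (integrable_graphonM hW (measurable_comp_fst mu2)) => z [z1 _].
  exact: uM2.
have iB : (leb2 R).-integrable (unit_square R) (EFin \o B).
  apply: (integrable_graphonM hW (measurable_comp_snd mu2)) => z [_ z2].
  exact: uM2.
have iC : (leb2 R).-integrable (unit_square R) (EFin \o C).
  have -> : C = fun z => W z * (u z.1 * u z.2).
    by apply/funext => z; rewrite mulrA.
  apply: (integrable_graphonM (M := M * M) hW (measurable_funM mu1 mu1')).
  by move=> z [z1 z2]; rewrite normrM ler_pM// uM.
have iAB : (leb2 R).-integrable (unit_square R) (EFin \o (fun z => A z + B z)).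
  have := integrableD mS iA iB; exact: eq_integrable.
have iCC : (leb2 R).-integrable (unit_square R) (EFin \o (fun z => C z + C z)).
  have := integrableD mS iC iC; exact: eq_integrable.
have iD : (leb2 R).-integrable (unit_square R)
    (EFin \o (fun z => (A z + B z) - (C z + C z))).
  have := integrableB mS iAB iCC; exact: eq_integrable.
have : 0 <= \int[leb2 R]_(z in unit_square R) ((A z + B z) - (C z + C z)).
  (* As [W] is nonnegative only almost everywhere, the integrand is replaced by its absolute value,
     which is nonnegative at every point. *)
  rewrite /Rintegral (@ae_eq_integral _ _ _ (leb2 R) _
    (fun z => (`|(A z + B z) - (C z + C z)|)%:E))//.
  - by rewrite fine_ge0// integral_ge0// => z _; rewrite lee_fin.
  - exact: measurable_int iD.
  - apply/measurable_EFinP; apply: measurableT_comp => //.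
    by apply/measurable_EFinP; exact: measurable_int iD.
  - apply: filterS W0 => z Wz Sz; congr EFin; rewrite ger0_norm//.
    rewrite [X in 0 <= X](_ : _ = W z * (u z.1 - u z.2) ^+ 2).
      by rewrite mulr_ge0 ?Wz ?sqr_ge0.
    by rewrite /A /B /C; ring.
rewrite RintegralB// !RintegralD//.
have -> : \int[leb2 R]_(z in unit_square R) A z =
    \int[leb R]_(x in unit_interval R) u x ^+ 2.
  by congr fine; exact: integral_graphon_fst uM2.
have -> : \int[leb2 R]_(z in unit_square R) B z =
    \int[leb R]_(x in unit_interval R) u x ^+ 2.
  by congr fine; exact: integral_graphon_snd uM2.
by rewrite /C; lra.
Qed.

(** * Moments and integrability on the unit interval *)

Lemma lebesgue_unit_interval (R : realType) : leb R (unit_interval R) = 1%E.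
Proof. by rewrite /unit_interval lebesgue_measure_itv/= lte01 oppr0 adde0. Qed.

Lemma Rintegral_unit_cst (R : realType) (c : R) :
  \int[leb R]_(x in unit_interval R) c = c.
Proof.
have mI : measurable (unit_interval R) by exact: measurable_itv.
apply: (@etrans _ _ (c * fine (leb R (unit_interval R)))).
  exact: Rintegral_cst.
by rewrite lebesgue_unit_interval/= mulr1.
Qed.

Lemma bounded_integrable_unit (R : realType) (u : measurableTypeR R -> R)
    (M : R) :
  measurable_fun (unit_interval R) u ->
  (forall x, unit_interval R x -> `|u x| <= M) ->
  (leb R).-integrable (unit_interval R) (EFin \o u).
Proof.
move=> mu uM; apply: measurable_bounded_integrable => //.
- exact: measurable_itv.
- by rewrite [X in (X < _)%E](lebesgue_unit_interval R) ltry.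
- exists M; split; first exact: num_real.
  by move=> N MN x Ix; rewrite /= (le_trans (uM x Ix))// ltW.
Qed.

(** This reduces the integrals of [1 - g], [(1 - g) ^+ 2], [(g - q) ^+ 2] and of the tangent bound
    to the first two moments of [g]. *)
Lemma Rintegral_quadratic (R : realType) (g : measurableTypeR R -> R)
    (a b c : R) :
  measurable_fun (unit_interval R) g ->
  (forall x, unit_interval R x -> 0 <= g x <= 1) ->
  (leb R).-integrable (unit_interval R)
    (EFin \o (fun x => a * g x ^+ 2 + b * g x + c)) /\
  \int[leb R]_(x in unit_interval R) (a * g x ^+ 2 + b * g x + c) =
  a * \int[leb R]_(x in unit_interval R) (g x ^+ 2)
  + b * \int[leb R]_(x in unit_interval R) g x + c.
Proof.
move=> mg g01.
have mI : measurable (unit_interval R) by exact: measurable_itv.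
have bnd (k : measurableTypeR R -> R) (M : R) := @bounded_integrable_unit R k M.
have mg2 : measurable_fun (unit_interval R) (fun x => g x ^+ 2).
  exact: measurable_funX.
have g1 x : unit_interval R x -> `|g x| <= 1.
  by move=> /g01/andP[g0 ?]; rewrite ger0_norm.
have g2 x : unit_interval R x -> `|g x ^+ 2| <= 1.
  by move=> /g1 ?; rewrite normrX expr_le1.
have mag2 : measurable_fun (unit_interval R) (fun x => a * g x ^+ 2).
  exact: measurable_funM.
have mbg : measurable_fun (unit_interval R) (fun x => b * g x).
  exact: measurable_funM.
have bndZ (k : R) t : `|t| <= 1 -> `|k * t| <= `|k|.
  by move=> t1; rewrite normrM ler_piMr.
have iag2 : (leb R).-integrable (unit_interval R)
    (EFin \o (fun x => a * g x ^+ 2)).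
  by apply: (bnd _ `|a| mag2) => x Ix; apply: bndZ; exact: g2.
have ibg : (leb R).-integrable (unit_interval R) (EFin \o (fun x => b * g x)).
  by apply: (bnd _ `|b| mbg) => x Ix; apply: bndZ; exact: g1.
have ic : (leb R).-integrable (unit_interval R) (EFin \o (fun=> c)).
  by apply: (bnd _ `|c|) => //; exact: measurable_cst.
have iab : (leb R).-integrable (unit_interval R)
    (EFin \o (fun x => a * g x ^+ 2 + b * g x)).
  have := integrableD mI iag2 ibg; exact: eq_integrable.
split; first by have := integrableD mI iab ic; exact: eq_integrable.
rewrite RintegralD// RintegralD// Rintegral_unit_cst.
rewrite !RintegralZl//; first exact: bnd mg g1.
exact: bnd mg2 g2.
Qed.

(** The inequality [ln (t^-1) <= t^-1 - 1] gives [t - 1 <= t * ln t]; adding the cases [x] and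
    [1 - x] yields the bound. It makes the entropy of a profile bounded, hence integrable. *)
Lemma neg_entropy_geN1 (R : realType) (x : R) : 0 <= x <= 1 ->
  - 1 <= neg_entropy x.
Proof.
have xlnx (t : R) : 0 <= t <= 1 -> t - 1 <= t * ln t.
  move=> /andP[]; rewrite le_eqVlt => /predU1P[<-|t0] t1.
    by rewrite mul0r sub0r lerN10.
  have : ln (t^-1) <= t^-1 - 1.
    have := @le_ln1Dx R (t^-1 - 1); rewrite [1 + _]addrC subrK; apply.
    by rewrite ltrBDl subrr invr_gt0.
  rewrite lnV ?posrE// -(ler_pM2l t0) mulrN mulrBr mulr1 divff ?gt_eqF//; lra.
move=> x01; rewrite /neg_entropy.
have x01' : 0 <= 1 - x <= 1 by lra.
have := xlnx _ x01; have := xlnx _ x01'; lra.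
Qed.

Lemma measurable_neg_entropy (R : realType) (g : measurableTypeR R -> R) :
  measurable_fun (unit_interval R) g ->
  measurable_fun (unit_interval R) (fun x => neg_entropy (g x)).
Proof.
move=> mg.
have mg' : measurable_fun (unit_interval R) (fun x => 1 - g x).
  by apply: measurable_funB => //; exact: measurable_cst.
have ml (k : measurableTypeR R -> R) : measurable_fun (unit_interval R) k ->
    measurable_fun (unit_interval R) (fun x => k x * ln (k x)).
  by move=> mk; apply: measurable_funM => //;
    apply: measurableT_comp => //; exact: measurable_ln.
by apply: measurable_funD; exact: ml.
Qed.

(** * The entropy functional and its lower bound *)

(** The Kullback-Leibler divergence of the Bernoulli law of parameter [q] from that of parameter
    [p]. *)
Definition bernoulli_divergence (R : realType) (q p : R) : R :=
  q * ln (q / p) + (1 - q) * ln ((1 - q) / (1 - p)).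

Lemma bernoulli_divergenceE (R : realType) (q p : R) :
  0 < q < 1 -> 0 < p < 1 ->
  bernoulli_divergence q p = neg_entropy q - q * ln p - (1 - q) * ln (1 - p).
Proof.
move=> /andP[q0 q1] /andP[p0 p1].
rewrite /bernoulli_divergence /neg_entropy !ln_div ?posrE ?subr_gt0//; ring.
Qed.

Section profile.
Variables (R : realType) (h : 'I_2 -> R) (p : R).
Hypotheses (p0 : 0 < p) (p1 : p < 1).
Let Z := expR (h ord0) + expR (h ord_max).
Hypothesis h0 : p = expR (h ord0) / Z.
Hypothesis h1 : 1 - p = expR (h ord_max) / Z.

Lemma gibbs_weights : h ord0 = ln p + ln Z /\ h ord_max = ln (1 - p) + ln Z.
Proof.
have Z0 : 0 < Z by rewrite addr_gt0 ?expR_gt0.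
have lnw (t : R) : ln (expR t / Z) + ln Z = t.
  by rewrite ln_div ?posrE ?expR_gt0// expRK subrK.
by rewrite h1 h0 !lnw.
Qed.

(** By [gibbs_weights], each [h r] contributes [ln Z] times the integral of [f r]. These integrals
    sum to one, so the normalizing [ln Z] cancels and only [f ord0] remains. *)
Lemma entropy_energyE (f : 'I_2 -> measurableTypeR R -> R) :
  colour_profile f ->
  entropy_energy h f + ln Z =
  \int[leb R]_(x in unit_interval R) neg_entropy (f ord0 x)
  - ln p * \int[leb R]_(x in unit_interval R) f ord0 x
  - ln (1 - p) * (1 - \int[leb R]_(x in unit_interval R) f ord0 x).
Proof.
move=> [mf f01 f1].
have fmax x : unit_interval R x -> f ord_max x = 1 - f ord0 x.
  by move=> Ix; rewrite -(f1 x Ix) addrC addKr.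
have ord1E : lift ord0 ord0 = ord_max :> 'I_2 by exact/val_inj.
rewrite /entropy_energy !big_ord_recl !big_ord0 ord1E !addr0.
have -> : \int[leb R]_(u in unit_interval R) (\sum_(r < 2) f r u * ln (f r u))
    = \int[leb R]_(x in unit_interval R) neg_entropy (f ord0 x).
  apply: eq_Rintegral => x /set_mem Ix.
  by rewrite !big_ord_recl big_ord0 ord1E addr0 fmax.
have -> : \int[leb R]_(x in unit_interval R) f ord_max x =
    1 - \int[leb R]_(x in unit_interval R) f ord0 x.
  have [_ E] := Rintegral_quadratic 0 (- 1) 1 (mf ord0) (f01 ord0).
  rewrite mul0r add0r mulN1r addrC in E; rewrite -E.
  by apply: eq_Rintegral => x /set_mem Ix; rewrite fmax//; ring.
have [-> ->] := gibbs_weights; ring.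
Qed.

Lemma entropy_energy_cst (q : R) : 0 < q < 1 ->
  let f (r : 'I_2) (x : measurableTypeR R) := if r == ord0 then q else 1 - q in
  colour_profile f /\
  entropy_energy h f + ln Z = bernoulli_divergence q p.
Proof.
move=> q01 f; have cf : colour_profile f.
  split=> [r|r x _|x _]; first exact: measurable_cst.
  - by rewrite /f; case: ifP => _; lra.
  - by rewrite /f/= addrC subrK.
split => //.
rewrite entropy_energyE// bernoulli_divergenceE//; last exact/andP.
rewrite /f/= !Rintegral_unit_cst; ring.
Qed.

(** With [m] and [s] the first two moments of [f ord0], the integrated tangent bound leaves an
    inequality that is affine in [m] and [s]. *)
Lemma entropy_energy_ge (q : R) (f : 'I_2 -> measurableTypeR R -> R) :
  1 / 2 < p -> p <= q -> q < 1 -> colour_profile f ->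
  q ^+ 2 + (1 - q) ^+ 2 <= \int[leb R]_(x in unit_interval R) (f ord0 x ^+ 2) +
    \int[leb R]_(x in unit_interval R) (f ord_max x ^+ 2) ->
  bernoulli_divergence q p <= entropy_energy h f + ln Z.
Proof.
move=> p2 pq q1 cf; have [mf f01 f1] := cf.
have q01 : 0 < q < 1 by lra.
have p01 : 0 < p < 1 by lra.
rewrite (entropy_energyE cf) bernoulli_divergenceE//.
have mI : measurable (unit_interval R) by exact: measurable_itv.
set g := f ord0; set m := Rintegral _ _ g; set s := \int[_]_(x in _) (g x ^+ 2).
have quad a b c := @Rintegral_quadratic R g a b c (mf ord0) (f01 ord0).
have -> : \int[leb R]_(x in unit_interval R) (f ord_max x ^+ 2) = s - 2 * m + 1.
  have [_ E] := quad 1 (- 2) 1.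
  rewrite mul1r mulNr in E; rewrite -E.
  apply: eq_Rintegral => x /set_mem Ix.
  by rewrite (_ : f ord_max x = 1 - g x); [ring|rewrite -(f1 x Ix) addrC addKr].
move=> ys.
have sq : 0 <= s - 2 * q * m + q ^+ 2.
  have [_ E] := quad 1 (- (2 * q)) (q ^+ 2).
  rewrite mul1r mulNr in E; rewrite -E.
  apply: Rintegral_ge0 => x _.
  by rewrite [leRHS](_ : _ = (g x - q) ^+ 2) ?sqr_ge0//; ring.
have q2 : 0 < 2 * q - 1 by lra.
pose k := logit q / (2 * q - 1).
have kq : k * (2 * q - 1) = logit q by rewrite divfK ?gt_eqF.
have tang : neg_entropy q + k * ((s - m) - (q ^+ 2 - q)) <=
    \int[leb R]_(x in unit_interval R) neg_entropy (g x).
  have [iq E] := quad k (- k) (neg_entropy q - k * (q ^+ 2 - q)).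
  rewrite (_ : neg_entropy q + _ = k * s + - k * m +
    (neg_entropy q - k * (q ^+ 2 - q))); last by ring.
  rewrite -E; apply: le_Rintegral => //.
    have mne := measurable_neg_entropy (mf ord0).
    apply: (bounded_integrable_unit mne (M := 1)).
    move=> x /(f01 ord0) gx.
    by rewrite ler0_norm ?neg_entropy_le0// lerNl neg_entropy_geN1.
  move=> x /(f01 ord0) gx.
  have q12 : 1 / 2 < q by lra.
  have := neg_entropy_tangent q12 q1 kq gx; rewrite -/(g x); lra.
apply: (@le_trans _ _ (neg_entropy q + k * ((s - m) - (q ^+ 2 - q))
    - ln p * m - ln (1 - p) * (1 - m))); last by lra.
have lp : 0 <= logit p by rewrite -logit_half; apply: ler_logit; lra.
have lpq : logit p <= logit q by exact: ler_logit.
set D := s - m - (q ^+ 2 - q).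
(* In terms of the moments, the hypothesis on the sum of the squared integrals says exactly
   [0 <= D]. *)
have D0 : 0 <= D by rewrite /D; lra.
suff : 0 <= k * D + (q - m) * logit p by rewrite /logit; lra.
rewrite -(pmulr_rge0 _ q2).
(* The identity rests on [D + (2 * q - 1) * (q - m) = s - 2 * q * m + q ^+ 2], whose right side is
   the integral of [(g - q) ^+ 2]. Each product then has nonnegative factors, because
   [1 / 2 < p <= q]. *)
rewrite [leRHS](_ : _ = (logit q - logit p) * D +
  logit p * (s - 2 * q * m + q ^+ 2)); last by rewrite -kq /D; ring.
by rewrite addr_ge0// mulr_ge0// subr_ge0.
Qed.

End profile.

(** * Constant profiles and the equation for [q] *)

(** The integrand is [W z * c ^+ 2], so this is [integral_graphon_fst] for the constant function
    [c ^+ 2]. *)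
Lemma cst_profile_density (R : realType)
    (W : measurableTypeR R * measurableTypeR R -> R)
    (f : 'I_2 -> measurableTypeR R -> R) (r : 'I_2) (c : R) :
  graphon_space W ->
  {ae leb R, forall x, unit_interval R x ->
    (\int[leb R]_(y in unit_interval R) (W (x, y))%:E = 1)%E} ->
  (forall x, f r x = c) -> mono_density W r f = c ^+ 2.
Proof.
move=> hW hWdeg fc; rewrite -[RHS]Rintegral_unit_cst.
have mc : measurable_fun (unit_interval R) (fun=> c ^+ 2).
  exact: measurable_cst.
rewrite /Rintegral -(integral_graphon_fst hW hWdeg mc (M := `|c ^+ 2|))//.
by congr fine; apply: eq_integral => z _; rewrite !fc -mulrA expr2.
Qed.

Lemma sum_sqr_onem_inj (R : realFieldType) (x y : R) :
  1 / 2 < x -> 1 / 2 < y ->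
  x ^+ 2 + (1 - x) ^+ 2 = y ^+ 2 + (1 - y) ^+ 2 -> x = y.
Proof.
move=> x2 y2 xy; have : (x - y) * (x + y - 1) = 0 by lra.
by move/eqP; rewrite mulf_eq0 => /orP[]/eqP; lra.
Qed.

Lemma sum_sqr_onem_surj (R : rcfType) (p y : R) :
  1 / 2 < p -> p ^+ 2 + (1 - p) ^+ 2 <= y < 1 ->
  exists q : R, [/\ q ^+ 2 + (1 - q) ^+ 2 = y, p <= q & q < 1].
Proof.
move=> p2 /andP[py y1]; pose s := Num.sqrt (2 * y - 1).
have y2 : 0 <= 2 * y - 1 by nra.
have s2 : s ^+ 2 = 2 * y - 1 by exact: sqr_sqrtr.
have s0 : 0 <= s by exact: sqrtr_ge0.
(* The equation is equivalent to [(2 * q - 1) ^+ 2 = 2 * y - 1], and this is its larger root. *)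
exists ((1 + s) / 2); split.
- have -> : ((1 + s) / 2) ^+ 2 + (1 - (1 + s) / 2) ^+ 2 = (1 + s ^+ 2) / 2.
    by field.
  by rewrite s2; field.
- suff : 2 * p - 1 <= s by lra.
  by rewrite -(@ler_pXn2r _ 2)// ?nnegrE; [rewrite s2; lra|lra].
- suff : s < 1 by lra.
  by rewrite -(@ltr_pXn2r _ 2)// ?nnegrE// s2; lra.
Qed.

Theorem proposition2p14 (R : realType)
    (W : measurableTypeR R * measurableTypeR R -> R)
    (hW : graphon_space W)
    (hWdeg : {ae leb R, forall x, unit_interval R x ->
       (\int[leb R]_(y in unit_interval R) (W (x, y))%:E = 1)%E})
    (hWpos : {ae leb2 R, forall z, unit_square R z -> 0 < W z})
    (p : R) (hp : 1 / 2 < p < 1)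
    (mu : 'I_2 -> R) (hmu0 : mu ord0 = p) (hmu1 : mu ord_max = 1 - p)
    (alpha : 'I_2 -> R) (halpha : alpha ord0 = alpha ord_max)
    (halpha0 : 0 <= alpha ord0)
    (h : 'I_2 -> R)
    (hh : forall r, mu r = expR (h r) / (expR (h ord0) + expR (h ord_max)))
    (y : R) (hy : p ^+ 2 + (1 - p) ^+ 2 <= y < 1) :
  exists q : R,
    unique (fun q' : R => 1 / 2 < q' /\ q' ^+ 2 + (1 - q') ^+ 2 = y) q /\
    rate_function h W (fun _ => 1) y
      = (q * ln (q / p) + (1 - q) * ln ((1 - q) / (1 - p)))%:E.
Proof.
have /andP[p2 p1] := hp.
have [q [qy pq q1]] := sum_sqr_onem_surj p2 hy.
have q2 : 1 / 2 < q by exact: lt_le_trans pq.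
exists q; split.
  split=> // q' [q'2 q'y]; apply: sum_sqr_onem_inj => //.
  by rewrite qy q'y.
have p0 : 0 < p by lra.
have q01 : 0 < q < 1 by lra.
have h0 := hh ord0; have h1 := hh ord_max.
rewrite hmu0 in h0; rewrite hmu1 in h1.
rewrite /rate_function -/(bernoulli_divergence q p).
set Z := expR _ + _.
suff -> : ereal_inf [set (entropy_energy h f)%:E | f in
     [set f | colour_profile f /\
              (1 * mono_density W ord0 f
               + 1 * mono_density W ord_max f = y)%R]] =
    (bernoulli_divergence q p - ln Z)%:E by rewrite -EFinD subrK.
apply/eqP; rewrite eq_le; apply/andP; split; last first.
  (* Lower bound: for an admissible profile, the constraint and [integral_graphon_diag] for each
     colour bound the sum of the second moments below by [y]. *)
  apply: le_ereal_inf_tmp => _ [f [cf fy] <-].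
  rewrite lee_fin lerBlDr; apply: entropy_energy_ge => //.
  rewrite qy -fy !mul1r; have [mf f01 _] := cf.
  have W0 : {ae leb2 R, forall z, unit_square R z -> 0 <= W z}.
    by apply: filterS hWpos => z Wz Sz; exact/ltW/Wz.
  have fM r x : unit_interval R x -> `|f r x| <= 1.
    by move=> /(f01 r)/andP[fr0 fr1]; rewrite ger0_norm.
  by apply: lerD; apply: (integral_graphon_diag hW hWdeg W0 (mf _) (fM _)).
(* Upper bound: the constant profile with values [q] and [1 - q] is admissible and attains the
   claimed value. *)
have [cf fE] := entropy_energy_cst p0 p1 h0 h1 q01.
set f := fun r => _ in cf fE.
apply: ereal_inf_lbound; exists f; last by rewrite -fE addrK.
split=> //; rewrite !mul1r -qy.
by congr (_ + _); apply: cst_profile_density.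
Qed.
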